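(* Let $\mathcal C=\mathcal C(I,A,(\rho_i)_{i\in I},(C^a)_{a\in A})$ be a Cartan scheme such that $\mathcal R^{\mathrm{re}}(\mathcal C)$ is a finite root system of type $\mathcal C$. Let $a\in A$. Then $\operatorname{Hom}(\mathcal W(\mathcal C),a)$, partially ordered by the weak order $\le_R$, is a meet semilattice; that is, every finite non-empty subset has a meet (greatest lower bound).
   Context: Cartan schemes. Let $I,A$ be finite sets, $A\neq\emptyset$, and $(\alpha_i)_{i\in I}$ the standard basis of $\mathbb Z^I$. A Cartan scheme $\mathcal C=\mathcal C(I,A,(\rho_i)_{i\in I},(C^a)_{a\in A})$ consists of maps $\rho_i:A\to A$ ($i\in I$) and (integer) generalized Cartan matrices $C^a=(c^a_{jk})_{j,k\in I}$ ($a\in A$) such that $\rho_i^2=\mathrm{id}$ and $c^a_{ij}=c^{\rho_i(a)}_{ij}$ for all $a\in A$, $i,j\in I$. Define $\sigma_i^a\in\operatorname{Aut}(\mathbb Z^I)$ by $\sigma_i^a(\alpha_j)=\alpha_j-c^a_{ij}\alpha_i$ for all $j\in I$. Weyl groupoid. $\mathcal W(\mathcal C)$ is the category (a groupoid) with object set $A$ whose morphisms are the compositions of the maps $\sigma_i^a$, each regarded as an element of $\operatorname{Hom}(a,\rho_i(a))$ (morphisms with the same source and target are equal iff they are equal as linear maps). Upper indices are omitted when determined by context; $\mathrm{id}^a\sigma_{i_1}\cdots\sigma_{i_k}$ denotes the composition with target $a$. $\operatorname{Hom}(\mathcal W(\mathcal C),a)$ is the disjoint union $\bigcup_{b\in A}\operatorname{Hom}(b,a)$.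 Roots. $(R^{\mathrm{re}})^a=\{\mathrm{id}^a\sigma_{i_1}\cdots\sigma_{i_k}(\alpha_j)\mid k\ge 0,\ i_1,\dots,i_k,j\in I\}$, and $\mathcal R^{\mathrm{re}}(\mathcal C)=(\mathcal C,((R^{\mathrm{re}})^a)_{a\in A})$. A family $(R^a)_{a\in A}$ of subsets of $\mathbb Z^I$ is a root system of type $\mathcal C$ if, with $R^a_+=R^a\cap\mathbb N_0^I$ and $m^a_{i,j}=|R^a\cap(\mathbb N_0\alpha_i+\mathbb N_0\alpha_j)|$: (R1) $R^a=R^a_+\cup -R^a_+$; (R2) $R^a\cap\mathbb Z\alpha_i=\{\alpha_i,-\alpha_i\}$; (R3) $\sigma_i^a(R^a)=R^{\rho_i(a)}$; (R4) if $i\ne j$ and $m^a_{i,j}$ is finite then $(\rho_i\rho_j)^{m^a_{i,j}}(a)=a$; for all $a\in A$, $i,j\in I$. It is finite if every $R^a$ is finite. Length and weak order. For a morphism $w$, $\ell(w)$ is the least $k\ge0$ such that $w$ is a composition $\sigma_{i_1}\cdots\sigma_{i_k}^b$. For $u\in\operatorname{Hom}(b,a)$, $v\in\operatorname{Hom}(c,b)$ put $u\le_R uv$ iff $\ell(u)+\ell(v)=\ell(uv)$; this is a partial order on $\operatorname{Hom}(\mathcal W(\mathcal C),a)$ (weak order). *)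

(* Defs.v *)
From HB Require Import structures.
From mathcomp Require Import all_boot all_order all_algebra.
From mathcomp Require Import mathcomp_extra boolp classical_sets functions.
From mathcomp Require Import cardinality.

Set Implicit Arguments.
Unset Strict Implicit.
Unset Printing Implicit Defensive.

Import Order.TTheory GRing.Theory Num.Theory.

Local Open Scope classical_set_scope.
Local Open Scope card_scope.
Local Open Scope ring_scope.

(* Z^I; the regular module int^o makes it a vectType over int, so that 'End(_)
   is the type of its Z-linear endomorphisms, with extensional equality. *)
Notation lattice I := {ffun I -> int^o}.

Definition alpha (I : finType) (i : I) : lattice I := [ffun k => (k == i)%:R].

Definition is_gcm (I : finType) (c : I -> I -> int) : Prop :=
  [/\ forall i, c i i = 2,
      forall i j, i != j -> c i j <= 0
    & forall i j, c i j = 0 -> c j i = 0].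

Record cartan_scheme (I A : finType) := CartanScheme {
  cs_obj_neq0 : (0 < #|A|)%N;
  cs_rho : I -> A -> A;
  cs_mat : A -> I -> I -> int;
  cs_gcm : forall a, is_gcm (cs_mat a);
  cs_rhoK : forall i a, cs_rho i (cs_rho i a) = a;
  cs_mat_rho : forall a i j, cs_mat a i j = cs_mat (cs_rho i a) i j
}.

Section WeylGroupoid.
Variables (I A : finType) (C : cartan_scheme I A).
Implicit Types (a b : A) (i j : I) (s : seq I).

Definition sigma_fun a i (v : lattice I) : lattice I :=
  \sum_j (v j : int) *: (alpha j - cs_mat C a i j *: alpha i).

Fact sigma_fun_is_linear a i : linear (sigma_fun a i).
Proof.
move=> k u v; rewrite /sigma_fun scaler_sumr -big_split /=.
by apply: eq_bigr => j _; rewrite !ffunE scalerDl scalerA.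
Qed.
HB.instance Definition _ a i :=
  GRing.isLinear.Build int (lattice I) (lattice I) _ (sigma_fun a i)
    (sigma_fun_is_linear a i).

Definition sigma a i : 'End(lattice I) := linfun (sigma_fun a i).

Lemma sigma_alpha a i j :
  sigma a i (alpha j) = alpha j - cs_mat C a i j *: alpha i.
Proof.
rewrite lfunE /= /sigma_fun (bigD1 j) //= ffunE eqxx scale1r.
by rewrite big1 ?addr0 // => k /negPf kj; rewrite ffunE kj scale0r.
Qed.

(* For s = [:: i_1; ...; i_k], word_map a s is the linear map
   id^a sigma_{i_1} ... sigma_{i_k}, a composition with target a and with
   source word_src a s = rho_{i_k} (... (rho_{i_1} a)); the factor sigma_i
   into a is sigma_i^{rho_i(a)}. *)
Fixpoint word_src a s : A :=
  if s is i :: s' then word_src (cs_rho C i a) s' else a.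

Fixpoint word_map a s : 'End(lattice I) :=
  if s is i :: s' then
    (sigma (cs_rho C i a) i \o word_map (cs_rho C i a) s')%VF
  else \1%VF.

Lemma word_src_cat a s t : word_src a (s ++ t) = word_src (word_src a s) t.
Proof. by elim: s a => //= i s IHs a. Qed.

Lemma word_map_cat a s t :
  word_map a (s ++ t) = (word_map a s \o word_map (word_src a s) t)%VF.
Proof.
by elim: s a => [|i s IHs] a /=; rewrite ?comp_lfun1l // IHs comp_lfunA.
Qed.

(* wmor b a is Hom(b, a) in the Weyl groupoid. *)
Record wmor b a := WMor {
  wmor_lin : 'End(lattice I);
  wmorP : exists s, word_src a s = b /\ word_map a s = wmor_lin
}.

Lemma wmor_inj b a : injective (@wmor_lin b a).
Proof.
by case=> f fP [g gP] /= fg; case: g / fg gP => gP; congr WMor.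
Qed.

Fact wcomp_subproof a b c (u : wmor b a) (v : wmor c b) :
  exists s, word_src a s = c /\
            word_map a s = (wmor_lin u \o wmor_lin v)%VF.
Proof.
have [[s [sb <-]] [t [tc <-]]] := (wmorP u, wmorP v).
by exists (s ++ t); rewrite word_src_cat word_map_cat sb.
Qed.

Definition wcomp a b c (u : wmor b a) (v : wmor c b) : wmor c a :=
  WMor (wcomp_subproof u v).

Definition has_word_of_size b a (w : wmor b a) (k : nat) : bool :=
  `[< exists s, [/\ size s = k, word_src a s = b
                  & word_map a s = wmor_lin w] >].

Fact wlen_subproof b a (w : wmor b a) : exists k, has_word_of_size w k.
Proof.
by have [s [sb sw]] := wmorP w; exists (size s); apply/asboolP; exists s.
Qed.

Definition wlen b a (w : wmor b a) : nat := ex_minn (wlen_subproof w).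

Definition wmor_to a : Type := {b : A & wmor b a}.

Definition weak_le a (x y : wmor_to a) : Prop :=
  exists v : wmor (tag y) (tag x),
    tagged y = wcomp (tagged x) v /\
    (wlen (tagged x) + wlen v)%N = wlen (wcomp (tagged x) v).

Definition real_roots a : set (lattice I) :=
  [set v | exists s j, v = word_map a s (alpha j)].

Definition pos_cone : set (lattice I) := [set v | forall i, (0 : int) <= v i].

Definition pos_roots (R : set (lattice I)) : set (lattice I) :=
  R `&` pos_cone.

Definition rank2_roots (R : set (lattice I)) i j : set (lattice I) :=
  R `&` [set v | exists p q : nat, v = alpha i *+ p + alpha j *+ q].

Record is_root_system (R : A -> set (lattice I)) : Prop := IsRootSystem {
  rootsR1 : forall a, R a = pos_roots (R a) `|` (-%R @` pos_roots (R a));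
  rootsR2 : forall a i,
    R a `&` [set v | exists z : int, v = z *: alpha i]
      = [set alpha i; - alpha i];
  rootsR3 : forall a i, sigma a i @` R a = R (cs_rho C i a);
  rootsR4 : forall a i j (m : nat), i != j ->
    rank2_roots (R a) i j #= `I_m ->
    iter m (cs_rho C i \o cs_rho C j) a = a
}.

Definition is_finite_root_system (R : A -> set (lattice I)) : Prop :=
  is_root_system R /\ forall a, finite_set (R a).

End WeylGroupoid.

Definition is_partial_order (T : Type) (le : T -> T -> Prop) : Prop :=
  [/\ forall x, le x x,
      forall x y, le x y -> le y x -> x = y
    & forall x y z, le x y -> le y z -> le x z].

Definition is_meet (T : Type) (le : T -> T -> Prop) (X : set T) (m : T) : Prop :=
  (forall x, X x -> le m x) /\
  (forall y, (forall x, X x -> le y x) -> le y m).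

Definition is_meet_semilattice (T : Type) (le : T -> T -> Prop) : Prop :=
  is_partial_order le /\
  forall X : set T, finite_set X -> X !=set0 -> exists m, is_meet le X m.

(* Main.v *)
(* For a morphism w with target a let N(w) be the set of positive roots at a that
   w^-1 makes negative. Each sigma_i permutes the positive roots other than
   alpha_i, so prefixing w by sigma_i changes |N(w)| by one; removing simple
   roots of N(w) one by one produces a word of length |N(w)| with the same N.
   For i != j the two alternating words in i, j whose length m is the number of
   positive roots in the span of alpha_i, alpha_j both have all these roots as
   inversion set. They have the same source by (R4), and the quotient of their
   maps preserves positivity both ways, hence permutes the simple roots, hence is
   the identity. As in Matsumoto's theorem, induction on length then shows that N
   determines the morphism, so that the length is |N(w)| and the weak order is
   inclusion of inversion sets. If N(w) contains alpha_i and alpha_j it contains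
   all positive roots in their span, so joins of two bounded atoms exist, and a
   Newman-type induction yields the meets. *)

Require Import Defs.
From mathcomp Require Import all_boot all_order all_algebra.
From mathcomp Require Import finmap.
From mathcomp Require Import boolp classical_sets cardinality.
From mathcomp Require Import zify.

Set Implicit Arguments.
Unset Strict Implicit.
Unset Printing Implicit Defensive.

Import Order.TTheory GRing.Theory Num.Theory.

Local Open Scope ring_scope.

(** Used to set aside [alpha i], the one positive root that the reflection in [i] makes negative. *)
Lemma count_split (T : eqType) (P : pred T) (s : seq T) x :
  uniq s -> x \in s ->
  count P s = (P x + count (predI P (predC1 x)) s)%N.
Proof.
move=> us xs; rewrite -size_filter -(count_predC (pred1 x)); congr addn.
  by rewrite count_uniq_mem ?filter_uniq // mem_filter xs andbT.
by rewrite count_filter; apply: eq_count => y /=; rewrite andbC.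
Qed.

(** * The lattice: nonnegative vectors, simple roots, linear maps *)

Section Lattice.
Variable I : finType.
Implicit Types (u v : lattice I) (i j k : I).

Definition nonneg v : bool := [forall k, (0 : int) <= v k].

Lemma nonnegP v : reflect (forall k, (0 : int) <= v k) (nonneg v).
Proof. exact: forallP. Qed.

Lemma alpha_neq0 i : alpha i != 0.
Proof.
by apply/eqP => /ffunP/(_ i)/eqP; rewrite !ffunE eqxx.
Qed.

Lemma alphaE i k : alpha i k = ((k == i)%:R : int).
Proof. by rewrite ffunE. Qed.

Lemma nonneg_alpha i : nonneg (alpha i).
Proof. by apply/nonnegP => k; rewrite alphaE ler0n. Qed.

Lemma latticeZE (z : int) v k : (z *: v) k = (z * v k : int).
Proof. by rewrite ffunE. Qed.

Lemma nonnegD u v : nonneg u -> nonneg v -> nonneg (u + v).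
Proof.
move=> /nonnegP u0 /nonnegP v0; apply/nonnegP => k; rewrite ffunE.
exact: addr_ge0 (u0 k) (v0 k).
Qed.

Lemma nonnegZ (z : int) v : 0 <= z -> nonneg v -> nonneg (z *: v).
Proof.
move=> z0 /nonnegP v0; apply/nonnegP => k; rewrite ffunE.
exact: mulr_ge0 z0 (v0 k).
Qed.

Lemma nonneg_sum (J : finType) (F : J -> lattice I) :
  (forall x, nonneg (F x)) -> nonneg (\sum_x F x).
Proof.
move=> F0; elim/big_rec: _ => [|x v _ v0]; last exact: nonnegD.
by apply/nonnegP => k; rewrite ffunE.
Qed.

Lemma nonneg_anti v : nonneg v -> nonneg (- v) -> v = 0.
Proof.
move=> /nonnegP v0 /nonnegP v1; apply/ffunP => k; rewrite [RHS]ffunE.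
apply: le_anti; apply/andP; split; last exact: v0.
by have := v1 k; rewrite ffunE oppr_ge0.
Qed.

Lemma lattice_basis v : v = \sum_j (v j : int) *: alpha j.
Proof.
apply/ffunP => k; rewrite sum_ffunE (bigD1 k) //= latticeZE alphaE eqxx mulr1.
rewrite big1 ?addr0 // => j jk.
by rewrite latticeZE alphaE eq_sym (negPf jk) mulr0.
Qed.

Lemma lfun_basis (f : 'End(lattice I)) v :
  f v = \sum_j (v j : int) *: f (alpha j).
Proof.
by rewrite {1}[v]lattice_basis linear_sum; apply: eq_bigr => j _; rewrite linearZ.
Qed.

Lemma eq_lfun_alpha (f g : 'End(lattice I)) :
  (forall i, f (alpha i) = g (alpha i)) -> f = g.
Proof.
move=> fg; apply/lfunP => v; rewrite !lfun_basis.
by apply: eq_bigr => j _; rewrite fg.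
Qed.

Lemma nonneg_lfun (f : 'End(lattice I)) v :
    nonneg v -> (forall i, v i != 0 -> nonneg (f (alpha i))) ->
  nonneg (f v).
Proof.
move=> /nonnegP v0 f0; rewrite lfun_basis; apply: nonneg_sum => j.
have [vj|vj] := eqVneq (v j) 0; last by apply: nonnegZ => //; apply: f0.
by rewrite vj scale0r; apply/nonnegP => k; rewrite ffunE.
Qed.

Definition in_span2 i j v : bool := [forall k, (k != i) && (k != j) ==> (v k == 0)].

Lemma in_span2P i j v :
  reflect (forall k, k != i -> k != j -> v k = 0) (in_span2 i j v).
Proof.
apply: (iffP forallP) => [H k ki kj|H k].
  by have := H k; rewrite ki kj => /eqP.
by apply/implyP => /andP[ki kj]; rewrite H.
Qed.

Lemma in_span2C i j v : in_span2 i j v = in_span2 j i v.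
Proof. by apply/in_span2P/in_span2P => H k k1 k2; apply: H. Qed.

End Lattice.

Section WeylGroupoid.
Variables (I A : finType) (C : cartan_scheme I A).
Implicit Types (a b : A) (i j k : I) (s t u : seq I) (v : lattice I).

Local Notation rho := (cs_rho C).
Local Notation sigma := (sigma C).
Local Notation src := (word_src C).
Local Notation wmap := (word_map C).

(** * Simple reflections, words and their inverses *)

Lemma sigmaE a i v :
  sigma a i v = v - (\sum_j (v j : int) * cs_mat C a i j) *: alpha i.
Proof.
rewrite lfun_basis [X in X - _]lattice_basis scaler_suml -sumrB.
by apply: eq_bigr => j _; rewrite sigma_alpha scalerBr scalerA.
Qed.

Lemma sigma_neq a i v k : k != i -> sigma a i v k = v k.
Proof. by move=> ki; rewrite sigmaE !ffunE (negPf ki) scaler0 subr0. Qed.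

Lemma sigma_alpha_self a i : sigma a i (alpha i) = - alpha i.
Proof.
rewrite sigma_alpha; have [-> _ _] := cs_gcm C a.
by rewrite scaler_nat mulr2n opprD addrA subrr sub0r.
Qed.

(** Rows [i] of the Cartan matrices at [a] and [rho i a] agree, so both reflections are one map,
    whose square is the identity. *)
Lemma sigmaK a i v : sigma (rho i a) i (sigma a i v) = v.
Proof.
suff -> : sigma (rho i a) i = sigma a i.
  rewrite [X in sigma a i X]sigmaE linearB linearZ /= sigma_alpha_self.
  by rewrite scalerN opprK sigmaE subrK.
by apply: eq_lfun_alpha => j; rewrite !sigma_alpha -cs_mat_rho.
Qed.

Lemma sigmaKV a i v : sigma a i (sigma (rho i a) i v) = v.
Proof. by have := sigmaK (rho i a) i v; rewrite cs_rhoK. Qed.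

(** The inverse of [word_map], by [inv_mapK] and [word_mapK]. Inversions are tested by it, since it
    carries roots at the target [a] to roots at the source. *)
Fixpoint inv_map a s : 'End(lattice I) :=
  if s is i :: s' then (inv_map (rho i a) s' \o sigma a i)%VF else \1%VF.

Lemma inv_map_cons a i s v :
  inv_map a (i :: s) v = inv_map (rho i a) s (sigma a i v).
Proof. by rewrite /= comp_lfunE. Qed.

Lemma inv_map_cat a s t v :
  inv_map a (s ++ t) v = inv_map (src a s) t (inv_map a s v).
Proof.
by elim: s a v => [|i s IHs] a v; rewrite ?id_lfunE //= !comp_lfunE IHs.
Qed.

Lemma inv_mapN a s v : inv_map a s (- v) = - inv_map a s v.
Proof. exact: linearN. Qed.

Lemma inv_mapK a s v : wmap a s (inv_map a s v) = v.
Proof.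
elim: s a v => [|i s IHs] a v; first by rewrite !id_lfunE.
by rewrite /= !comp_lfunE IHs sigmaK.
Qed.

Lemma word_mapK a s v : inv_map a s (wmap a s v) = v.
Proof.
elim: s a v => [|i s IHs] a v; first by rewrite !id_lfunE.
by rewrite /= !comp_lfunE sigmaKV IHs.
Qed.

Lemma word_src_rev a s : src (src a s) (rev s) = a.
Proof.
elim: s a => //= i s IHs a.
by rewrite rev_cons -cats1 word_src_cat IHs /= cs_rhoK.
Qed.

Lemma word_src_revV a s : src (src a (rev s)) s = a.
Proof. by rewrite -[X in src _ X]revK word_src_rev. Qed.

Lemma inv_map_rev a s v : inv_map (src a s) (rev s) v = wmap a s v.
Proof.
elim: s a v => //= i s IHs a v.
by rewrite rev_cons -cats1 inv_map_cat IHs word_src_rev /= !comp_lfunE id_lfunE.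
Qed.

Lemma inv_map_rev_cat a s t v :
  inv_map (src a s) (rev s ++ t) (inv_map a s v) = inv_map a t v.
Proof. by rewrite inv_map_cat inv_map_rev inv_mapK word_src_rev. Qed.

Definition word_eq a s t := src a s = src a t /\ inv_map a s = inv_map a t.

Lemma word_map_eq a s t :
  word_eq a s t <-> src a s = src a t /\ wmap a s = wmap a t.
Proof.
split=> -[st e]; split=> //; apply/lfunP => v.
  by rewrite -[LHS](inv_mapK a t) -e word_mapK.
by rewrite -[LHS](word_mapK a t) -e inv_mapK.
Qed.

Lemma word_eq_sym a s t : word_eq a s t -> word_eq a t s.
Proof. by case. Qed.

Lemma word_eq_trans a s t u : word_eq a s t -> word_eq a t u -> word_eq a s u.
Proof. by case=> s1 i1 [s2 i2]; rewrite /word_eq s1 i1. Qed.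

Lemma word_eq_cat a s s' t t' :
  word_eq a s s' -> word_eq (src a s) t t' -> word_eq a (s ++ t) (s' ++ t').
Proof.
case=> es es' [et et']; split; first by rewrite !word_src_cat et es.
by apply/lfunP => v; rewrite !inv_map_cat et' es' es.
Qed.

Lemma word_eq_revK a s t : word_eq a (s ++ rev s ++ t) t.
Proof.
split; first by rewrite !word_src_cat word_src_rev.
by apply/lfunP => v; rewrite inv_map_cat inv_map_rev_cat.
Qed.

Lemma word_eq_consK a i t : word_eq a (i :: i :: t) t.
Proof. exact: (word_eq_revK a [:: i]). Qed.

(** * Signs of real roots under simple reflections *)

Section RootSystem.
Hypothesis hC : is_finite_root_system C (real_roots C).
Local Notation R := (real_roots C).

Let rs : is_root_system C R. Proof. by case: hC. Qed.

Lemma root_sigma a i v : R a v -> R (rho i a) (sigma a i v).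
Proof. by move=> Rv; rewrite -(rootsR3 rs a i); exists v. Qed.

Lemma root_inv a s v : R a v -> R (src a s) (inv_map a s v).
Proof.
elim: s a v => [|i s IHs] a v Rv; first by rewrite id_lfunE.
by rewrite inv_map_cons; apply/IHs/root_sigma.
Qed.

Lemma root_word a s v : R (src a s) v -> R a (wmap a s v).
Proof.
by move=> /(root_inv (rev s)); rewrite word_src_rev inv_map_rev.
Qed.

Lemma root_alpha a i : R a (alpha i).
Proof. by exists [::], i; rewrite id_lfunE. Qed.

Lemma root_neq0 a v : R a v -> v != 0.
Proof.
case=> s [j ->]; apply/eqP => /(congr1 (inv_map a s)).
by rewrite word_mapK linear0; apply/eqP/alpha_neq0.
Qed.

Lemma rootN a v : R a v -> R a (- v).
Proof.
rewrite {1}(rootsR1 rs a) => -[[Rv v0]|[w [Rw w0] <-]]; last by rewrite opprK.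
by rewrite (rootsR1 rs a); right; exists v.
Qed.

(** (R1) makes [v] or [- v] nonnegative, and both cannot be since roots are nonzero. *)
Lemma nonneg_rootN a v : R a v -> nonneg (- v) = ~~ nonneg v.
Proof.
move=> Rv; have v0 := root_neq0 Rv; have [p|n] := boolP (nonneg v) => /=.
  by apply/negP => /(nonneg_anti p)/eqP; apply/negP.
move: Rv; rewrite (rootsR1 rs a) => -[[_ /nonnegP]|[w [_ /nonnegP w0] <-]].
  by rewrite (negPf n).
by rewrite opprK.
Qed.

Lemma root_alpha_multiple a i v :
  R a v -> nonneg v -> (forall k, k != i -> v k = 0) -> v = alpha i.
Proof.
move=> Rv v0 vk; have : [set alpha i; - alpha i]%classic v.
  rewrite -(rootsR2 rs a); split=> //; exists (v i).
  rewrite {1}[v]lattice_basis (bigD1 i) //= big1 ?addr0 // => k ki.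
  by rewrite vk // scale0r.
case=> // ve; move: v0; rewrite ve (nonneg_rootN (root_alpha a i)).
by rewrite nonneg_alpha.
Qed.

(** Only coordinate [i] changes. Were the image negative, all other coordinates of [v] would vanish,
    and (R2) would give [v = alpha i]. *)
Lemma nonneg_sigma a i v :
  R a v -> nonneg v -> v != alpha i -> nonneg (sigma a i v).
Proof.
move=> Rv v0 vi; have Rs := root_sigma i Rv.
apply: contraT; rewrite -(nonneg_rootN Rs) => /nonnegP n.
case/eqP: vi; apply: (root_alpha_multiple Rv v0) => k ki.
apply: le_anti; rewrite (nonnegP _ v0) andbT.
by have := n k; rewrite ffunE sigma_neq // oppr_ge0.
Qed.

Lemma nonneg_sigma_iff a i v :
  R a v -> nonneg v -> nonneg (sigma a i v) = (v != alpha i).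
Proof.
move=> Rv v0; have [->|] := eqVneq v (alpha i); last exact: nonneg_sigma.
by rewrite sigma_alpha_self (nonneg_rootN (root_alpha a i)) nonneg_alpha.
Qed.

(** * Inversion sets, their inclusion and their size *)

Definition roots a : seq (lattice I) := fset_set (R a).

Lemma mem_roots a v : v \in roots a <-> R a v.
Proof.
have [_ /(_ a) fin] := hC.
by rewrite /roots in_fset_set // inE.
Qed.

Lemma roots_uniq a : uniq (roots a).
Proof. exact: fset_uniq. Qed.

(* For a positive root v in R a, inversion a s v says that v lies in the
   inversion set N(w) of the morphism w spelled by s, and inv_count is |N(w)|. *)
Definition inversion a s v : bool := nonneg v && ~~ nonneg (inv_map a s v).
Definition inv_count a s : nat := count (inversion a s) (roots a).

Definition inv_le a s t := forall v, R a v -> inversion a s v -> inversion a t v.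
Definition inv_eq a s t := inv_le a s t /\ inv_le a t s.

Lemma inv_eq_sym a s t : inv_eq a s t -> inv_eq a t s. Proof. by case. Qed.

Lemma inv_le_trans a s t u : inv_le a s t -> inv_le a t u -> inv_le a s u.
Proof. by move=> st tu v Rv /(st _ Rv)/(tu _ Rv). Qed.

Lemma inv_eq_trans a s t u : inv_eq a s t -> inv_eq a t u -> inv_eq a s u.
Proof. by case=> ? ? [? ?]; split; apply: inv_le_trans; eassumption. Qed.

Lemma word_eq_inv_eq a s t : word_eq a s t -> inv_eq a s t.
Proof. by case=> _ e; split=> v _; rewrite /inversion e. Qed.

Lemma inv_eq_count a s t : inv_eq a s t -> inv_count a s = inv_count a t.
Proof.
case=> st ts; apply: eq_in_count => v /mem_roots Rv.
by apply/idP/idP; [apply: st|apply: ts].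
Qed.

Lemma inv_le_count a s t : inv_le a s t -> (inv_count a s <= inv_count a t)%N.
Proof.
move=> st; rewrite /inv_count.
have -> : count (inversion a s) (roots a) =
          count (predI (inversion a s) (inversion a t)) (roots a).
  apply: eq_in_count => v /mem_roots Rv /=.
  by case: (boolP (inversion a s v)) => // /(st v Rv) ->.
by apply: sub_count => v /andP[].
Qed.

Lemma inversion_alpha a s i :
  inversion a s (alpha i) = ~~ nonneg (inv_map a s (alpha i)).
Proof. by rewrite /inversion nonneg_alpha. Qed.

Lemma inversion_nil a v : inversion a [::] v = false.
Proof. by rewrite /inversion id_lfunE andbN. Qed.

Lemma inversion_cons_alpha a i s :
  inversion a (i :: s) (alpha i) = ~~ inversion (rho i a) s (alpha i).
Proof.
rewrite !inversion_alpha inv_map_cons sigma_alpha_self linearN /=.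
by rewrite (nonneg_rootN (root_inv _ (root_alpha _ _))).
Qed.

Lemma inversion_cons a i s v : R a v -> v != alpha i -> nonneg v ->
  inversion a (i :: s) v = inversion (rho i a) s (sigma a i v).
Proof.
by move=> Rv vi v0; rewrite /inversion inv_map_cons nonneg_sigma // v0.
Qed.

(** The root [alpha i] is an inversion of exactly one of [i :: s] and [s], and [sigma a i] matches
    the remaining inversions bijectively. Booleans on both sides avoid truncated subtraction. *)
Lemma inv_count_cons a i s :
  (inv_count a (i :: s) + inversion (rho i a) s (alpha i) =
   inv_count (rho i a) s + ~~ inversion (rho i a) s (alpha i))%N.
Proof.
have mi b : alpha i \in roots b by apply/mem_roots/root_alpha.
rewrite /inv_count (count_split _ (roots_uniq a) (mi a)).
rewrite (count_split _ (roots_uniq (rho i a)) (mi (rho i a))).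
rewrite inversion_cons_alpha.
suff -> : count (predI (inversion a (i :: s)) (predC1 (alpha i))) (roots a) =
  count (predI (inversion (rho i a) s) (predC1 (alpha i))) (roots (rho i a)).
  by case: (inversion _ s _) => /=; lia.
rewrite -!size_filter -(size_map (sigma a i)); apply: perm_size.
have inj : injective (sigma a i) by apply: can_inj (sigmaK a i).
apply: uniq_perm; rewrite ?map_inj_uniq ?filter_uniq ?roots_uniq //.
move=> v; apply/mapP/idP => [[w]|].
  rewrite !mem_filter /= => /andP[/andP[wi wni] /mem_roots Rw] ->.
  have w0 : nonneg w by case/andP: wi.
  rewrite -inversion_cons // wi /=; apply/andP; split; last first.
    by apply/mem_roots/root_sigma.
  apply/eqP => /(congr1 (sigma (rho i a) i)); rewrite sigmaK sigma_alpha_self.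
  by move=> we; move: w0; rewrite we (nonneg_rootN (root_alpha a i)) nonneg_alpha.
rewrite mem_filter /= => /andP[/andP[vi vni] /mem_roots Rv].
have v0 : nonneg v by case/andP: vi.
have Rw : R a (sigma (rho i a) i v) by rewrite -{1}(cs_rhoK C i a); apply: root_sigma.
have w0 := nonneg_sigma Rv v0 vni.
exists (sigma (rho i a) i v); last by rewrite sigmaKV.
have wi : sigma (rho i a) i v != alpha i.
  apply/eqP => /(congr1 (sigma a i)); rewrite sigmaKV sigma_alpha_self => ve.
  by move: v0; rewrite ve (nonneg_rootN (root_alpha a i)) nonneg_alpha.
rewrite mem_filter /= wi inversion_cons // sigmaKV vi /=.
exact/mem_roots.
Qed.


(** * Multiplying by and cancelling a left factor *)

Lemma inv_map_rev_catV a s t v :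
  inv_map (src a s) (rev s ++ t) v = inv_map a t (wmap a s v).
Proof. by rewrite -[v in LHS](word_mapK a s) inv_map_rev_cat. Qed.

Lemma inv_le_nil a s : inv_le a [::] s.
Proof. by move=> v _; rewrite inversion_nil. Qed.

Lemma inv_le_cat a s t u :
    inv_le a s t -> inv_le (src a s) u (rev s ++ t) ->
  inv_le a s (s ++ u) /\ inv_le a (s ++ u) t.
Proof.
move=> st ut; split=> v Rv.
  move=> sv; have /andP[v0 sv0] := sv; rewrite /inversion v0 inv_map_cat /=.
  (* If [v] were no longer inverted by [s ++ u], the positive root [- inv_map a s v] would be an
     inversion of [u], hence of [rev s ++ t], and [t] would not invert [v]. *)
  have Rs := root_inv s Rv; apply/negP => p.
  have := ut _ (rootN Rs); rewrite /inversion (nonneg_rootN Rs) sv0.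
  rewrite !inv_mapN inv_map_rev_cat (nonneg_rootN (root_inv _ Rs)) p.
  rewrite (nonneg_rootN (root_inv _ Rv)) negbK /= => /(_ isT).
  by have /andP[_ /negPf->] := st _ Rv sv.
rewrite /inversion inv_map_cat => /andP[v0 n].
have Rs := root_inv s Rv; have [p|q] := boolP (nonneg (inv_map a s v)).
  have := ut _ Rs; rewrite /inversion p n inv_map_rev_cat v0.
  exact.
by have := st _ Rv; rewrite /inversion v0 q; apply.
Qed.

(** Let [w] be the image of [v] under [s]. If [w] is positive, the inclusion [tu] applies to it. If
    not, [- w] is an inversion of [s], hence of [t], which contradicts that [rev s ++ t] inverts
    [v]. *)
Lemma inv_le_strip a s t u :
  inv_le a s t -> inv_le a t u -> inv_le (src a s) (rev s ++ t) (rev s ++ u).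
Proof.
move=> st tu v Rv; rewrite /inversion !inv_map_rev_catV => /andP[v0 n].
rewrite v0; have Rw := root_word Rv.
have [w0|w0] := boolP (nonneg (wmap a s v)).
  by have := tu _ Rw; rewrite /inversion w0 n; apply.
have := st _ (rootN Rw); rewrite /inversion (nonneg_rootN Rw) w0.
rewrite !inv_mapN word_mapK (nonneg_rootN Rv) v0 => /(_ isT) /=.
by rewrite (nonneg_rootN (root_inv _ Rw)) n.
Qed.

Lemma inv_eq_sign a s t v : inv_eq a s t -> R a v ->
  nonneg (inv_map a s v) = nonneg (inv_map a t v).
Proof.
move=> [st ts].
have pos w : R a w -> nonneg w -> nonneg (inv_map a s w) = nonneg (inv_map a t w).
  move=> Rw w0; apply: negb_inj; apply/idP/idP => n.
    by have := st w Rw; rewrite /inversion w0 n; apply.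
  by have := ts w Rw; rewrite /inversion w0 n; apply.
move=> Rv; have [|v0] := boolP (nonneg v); first exact: pos.
have /(pos _ (rootN Rv)) : nonneg (- v) by rewrite (nonneg_rootN Rv).
rewrite !inv_mapN !(nonneg_rootN (root_inv _ Rv)).
exact: negb_inj.
Qed.

Lemma inv_eq_catl a s t u : inv_eq (src a u) s t -> inv_eq a (u ++ s) (u ++ t).
Proof.
move=> e; split=> v Rv; rewrite /inversion !inv_map_cat;
  by rewrite (inv_eq_sign e (root_inv _ Rv)).
Qed.

(** * Simple inversions and reduced words *)

Lemma inversion_seq1 a i : inversion a [:: i] (alpha i).
Proof. by rewrite inversion_cons_alpha inversion_nil. Qed.

Lemma inv_le_seq1 a i s : inversion a s (alpha i) -> inv_le a [:: i] s.
Proof.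
move=> si v Rv iv; suff -> : v = alpha i by [].
apply/eqP; move: iv; rewrite /inversion inv_map_cons id_lfunE => /andP[v0].
by apply: contraR; apply: nonneg_sigma.
Qed.

Lemma no_simple_inversion a s :
  (forall i, ~~ inversion a s (alpha i)) -> inv_le a s [::].
Proof.
move=> H v Rv /andP[v0 /negP[]]; apply: nonneg_lfun v0 _ => i _.
by have := H i; rewrite inversion_alpha negbK.
Qed.

Lemma inv_count_nil a : inv_count a [::] = 0%N.
Proof.
by apply/eqP; rewrite -leqn0 leqNgt -has_count; apply/hasPn => v _; rewrite inversion_nil.
Qed.

Lemma inv_count_drop a i s : inversion a s (alpha i) ->
  inv_count a s = (inv_count (rho i a) (i :: s)).+1.
Proof.
by have := inv_count_cons (rho i a) i s; rewrite cs_rhoK => + si; rewrite si; lia.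
Qed.

Lemma inv_count_le_size a s : (inv_count a s <= size s)%N.
Proof.
elim: s a => [|i s IHs] a; first by rewrite inv_count_nil.
have := inv_count_cons a i s; have := IHs (rho i a) => /=.
by case: inversion => /=; lia.
Qed.

Lemma simple_inversion_or_nil a s :
  (exists i, inversion a s (alpha i)) \/ inv_le a s [::].
Proof.
have [i si|H] := pickP (fun i => inversion a s (alpha i)); first by left; exists i.
by right; apply: no_simple_inversion => i; rewrite H.
Qed.

(** Simple inversions are removed until none is left. This preserves only the inversion set;
    equality of the morphisms must wait for [exists_reduced_word]. *)
Lemma exists_reduced a s : exists t, size t = inv_count a t /\ inv_eq a t s.
Proof.
have [n] := ubnP (inv_count a s); elim: n a s => // n IHn a s sn.
have [[i si]|s0] := simple_inversion_or_nil a s; last first.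
  by exists [::]; rewrite inv_count_nil; split=> //; split=> //; apply: inv_le_nil.
have sd := inv_count_drop si.
have [|t [st et]] := IHn (rho i a) (i :: s); first by lia.
have e : inv_eq a (i :: t) s.
  apply: inv_eq_trans (word_eq_inv_eq (word_eq_consK a i s)).
  exact: (@inv_eq_catl a _ _ [:: i]).
by exists (i :: t); split=> //=; rewrite (inv_eq_count e) st (inv_eq_count et).
Qed.

(** Each letter adds at most one inversion, so in a word with as many inversions as letters the
    first letter must add one. *)
Lemma inversion_reduced_head a i s :
  size (i :: s) = inv_count a (i :: s) ->
  inversion a (i :: s) (alpha i) /\ size s = inv_count (rho i a) s.
Proof.
move=> /= ss; rewrite inversion_cons_alpha.
have := inv_count_cons a i s; have := inv_count_le_size (rho i a) s.
by case: inversion => /=; lia.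
Qed.

(** Cancelling the letters of [s] in turn removes one inversion of [t] each time. *)
Lemma inv_count_rev_cat_reduced a s t :
  size s = inv_count a s -> inv_le a s t ->
  (inv_count a s + inv_count (src a s) (rev s ++ t) = inv_count a t)%N.
Proof.
elim: s a t => [|i s IHs] a t; first by rewrite inv_count_nil.
move=> /[dup] /inversion_reduced_head[is_ rs_] ss st.
have ti : inversion a t (alpha i) by apply: st is_; apply: root_alpha.
have st' : inv_le (rho i a) s (i :: t).
  apply: inv_le_trans (proj2 (word_eq_inv_eq (word_eq_consK _ i s))) _.
  exact: (@inv_le_strip a [:: i] (i :: s) t (inv_le_seq1 is_) st).
rewrite -ss /= rs_ addSn rev_cons -cats1 -catA (IHs _ _ rs_ st').
by rewrite (inv_count_drop ti).
Qed.

(** * Alternating words and rank two *)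

Fixpoint alt i j n : seq I := if n is n'.+1 then i :: alt j i n' else [::].

Lemma size_alt i j n : size (alt i j n) = n.
Proof. by elim: n i j => //= n IHn i j; rewrite IHn. Qed.

Lemma alt_double_rcons i j n : i :: alt j i n.*2 = rcons (alt i j n.*2) i.
Proof. by elim: n => //= n ->. Qed.

(** One alternating word is continued by the inverse of the other, so (R4) becomes an equality of
    their sources. *)
Lemma alt_cat_rev i j n : alt j i n ++ rev (alt i j n) = alt j i n.*2.
Proof.
elim: n i j => //= n IHn i j.
by rewrite rev_cons -rcons_cat IHn alt_double_rcons.
Qed.

Lemma src_alt_double a i j n :
  src a (alt j i n.*2) = iter n (rho i \o rho j) a.
Proof. by elim: n a => //= n IHn a; rewrite IHn -iterSr. Qed.

Definition rank2_count a i j : nat :=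
  count (fun v => nonneg v && in_span2 i j v) (roots a).

Lemma rank2_countC a i j : rank2_count a i j = rank2_count a j i.
Proof. by apply: eq_count => v; rewrite in_span2C. Qed.

Lemma in_span2_sigma a i j v : in_span2 i j (sigma a i v) = in_span2 i j v.
Proof.
by apply/in_span2P/in_span2P => H k ki kj; have := H k ki kj; rewrite sigma_neq.
Qed.

Lemma in_span2_alpha i j : in_span2 i j (alpha i).
Proof. by apply/in_span2P => k ki _; rewrite alphaE (negPf ki). Qed.

Lemma rank2_rootsE a i j v : i != j ->
  rank2_roots (R a) i j v <-> [/\ R a v, nonneg v & in_span2 i j v].
Proof.
move=> ij; split=> [[Rv [p [q ve]]]|[Rv /nonnegP v0 /in_span2P vk]].
  split=> //; rewrite ve.
    by rewrite -!scaler_nat; apply: nonnegD; apply: nonnegZ => //; apply: nonneg_alpha.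
  apply/in_span2P => k ki kj.
  by rewrite -!scaler_nat ffunE !latticeZE !alphaE (negPf ki) (negPf kj) !mulr0 addr0.
split=> //; exists `|v i : int|%N, `|v j : int|%N.
rewrite -!scaler_nat !natz !gez0_abs //.
rewrite {1}[v]lattice_basis (bigD1 i) //= (bigD1 j) ?(eq_sym j) //= addrA.
by rewrite [X in _ + X]big1 ?addr0 // => k /andP[ki kj]; rewrite vk // scale0r.
Qed.

Lemma rank2_rho a i j : i != j -> iter (rank2_count a i j) (rho i \o rho j) a = a.
Proof.
move=> ij; apply: (rootsR4 rs) => //.
have <- : [set` [fset v in [seq v <- roots a | nonneg v && in_span2 i j v]]%fset]%classic
    = rank2_roots (R a) i j.
  apply/seteqP; split=> v; rewrite /= in_fset /= mem_filter.
    by move=> /andP[/andP[v0 vs] /mem_roots Rv]; apply/(rank2_rootsE _ _ ij).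
  by move=> /(rank2_rootsE _ _ ij)[Rv -> ->]; apply/mem_roots.
apply/card_eq_fsetP.
by rewrite card_fseq undup_id ?filter_uniq ?roots_uniq // size_filter.
Qed.

Lemma inv_map_alt_coord a i j n v k :
  k != i -> k != j -> inv_map a (alt i j n) v k = v k.
Proof.
elim: n i j a v => [|n IHn] i j a v ki kj; first by rewrite id_lfunE.
by rewrite inv_map_cons IHn // sigma_neq.
Qed.

(** The word leaves all coordinates outside [i], [j] unchanged; a positive one among them keeps the
    image from being negative. *)
Lemma alt_inversion_span a i j n v :
  R a v -> inversion a (alt i j n) v -> in_span2 i j v.
Proof.
move=> Rv /andP[v0]; apply: contraR => /forallPn[k].
rewrite negb_imply => /andP[/andP[ki kj] vk].
have Rs := root_inv (alt i j n) Rv.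
apply: contraT; rewrite -(nonneg_rootN Rs) => /nonnegP/(_ k).
rewrite ffunE inv_map_alt_coord // oppr_ge0 => vk'; case/eqP: vk.
by apply: le_anti; rewrite vk' (nonnegP _ v0).
Qed.

(** The negated inverse map sends [alpha i] and [alpha j] to nonnegative vectors, hence also their
    nonnegative combination [v]. *)
Lemma span2_inversion a i j s v :
    inversion a s (alpha i) -> inversion a s (alpha j) ->
  R a v -> nonneg v -> in_span2 i j v -> inversion a s v.
Proof.
move=> si sj Rv v0 /in_span2P vk; rewrite /inversion v0 /=.
have Rs := root_inv s Rv; rewrite -(nonneg_rootN Rs) -inv_mapN.
have -> : inv_map a s (- v) = (- inv_map a s)%R v by rewrite lfunE /= linearN.
apply: nonneg_lfun v0 _ => k vk0.
have : (k == i) || (k == j).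
  by apply: contraNT vk0; rewrite negb_or => /andP[ki kj]; rewrite vk.
have Ra := root_inv s (root_alpha a k).
rewrite lfunE /= (nonneg_rootN Ra) -inversion_alpha.
by case/orP => /eqP ->.
Qed.

(** The reflection in [i] preserves the plane and keeps its positive roots other than [alpha i]
    positive. One inequality suffices, [rho i] being an involution. *)
Lemma rank2_count_rho a i j : rank2_count (rho i a) i j = rank2_count a i j.
Proof.
suff le b : (rank2_count b i j <= rank2_count (rho i b) i j)%N.
  by apply/eqP; rewrite eqn_leq le -{2}(cs_rhoK C i a) le.
have mi c : alpha i \in roots c by apply/mem_roots/root_alpha.
rewrite /rank2_count (count_split _ (roots_uniq b) (mi b)).
rewrite (count_split _ (roots_uniq (rho i b)) (mi (rho i b))).
rewrite leq_add2l -!size_filter -(size_map (sigma b i)).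
apply: uniq_leq_size.
  by rewrite map_inj_uniq ?filter_uniq ?roots_uniq //; apply: can_inj (sigmaK b i).
move=> _ /mapP[v + ->]; rewrite !mem_filter /=.
move=> /andP[/andP[/andP[v0 vs] vi] /mem_roots Rv].
rewrite (nonneg_sigma Rv) // in_span2_sigma vs.
apply/andP; split; last exact/mem_roots/root_sigma.
apply/eqP => /(congr1 (sigma (rho i b) i)); rewrite sigmaK sigma_alpha_self => ve.
by move: v0; rewrite ve (nonneg_rootN (root_alpha b i)) nonneg_alpha.
Qed.

Lemma inv_count_alt a i j n :
  (n <= rank2_count a i j)%N -> inv_count a (alt i j n) = n.
Proof.
elim: n a i j => [|n IHn] a i j nm; first by rewrite inv_count_nil.
have nm' : (n < rank2_count (rho i a) j i)%N by rewrite rank2_countC rank2_count_rho.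
have cn := IHn (rho i a) j i (ltnW nm').
have := inv_count_cons a i (alt j i n); rewrite cn.
case: (boolP (inversion _ _ _)) => /= [ni _|_]; last by rewrite addn0 addn1.
(* If prefixing [i] loses an inversion, the shorter word inverts [alpha i]. It also inverts
   [alpha j], its first letter, hence all positive roots of the plane, which outnumber its
   inversions. *)
exfalso; case: n nm nm' cn ni {IHn} => [|n] nm nm' cn ni.
  by rewrite inversion_nil in ni.
have nj : inversion (rho i a) (alt j i n.+1) (alpha j).
  by have [] := @inversion_reduced_head (rho i a) j (alt i j n) _; rewrite ?cn //= size_alt.
move: nm'; rewrite -cn ltnNge => /negP[]; rewrite /rank2_count /inv_count.
have e : {in roots (rho i a), (fun v => nonneg v && in_span2 j i v) =1
   predI (fun v => nonneg v && in_span2 j i v) (inversion (rho i a) (alt j i n.+1))}.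
  move=> v /mem_roots Rv /=.
  case: (boolP (nonneg v && _)) => // /andP[v0 vs].
  by rewrite (span2_inversion nj ni).
by rewrite (eq_in_count e); apply: sub_count => v /andP[].
Qed.

Definition rank2_word a i j : seq I := alt i j (rank2_count a i j).

(** All inversions lie in the plane, and there are as many of them as positive roots in the
    plane. *)
Lemma inversion_rank2_word a i j v : R a v ->
  inversion a (rank2_word a i j) v = nonneg v && in_span2 i j v.
Proof.
move=> Rv; set s := rank2_word a i j.
have sub w : R a w -> inversion a s w -> nonneg w && in_span2 i j w.
  by move=> Rw sw; rewrite (alt_inversion_span Rw sw) andbT; case/andP: sw.
apply/idP/idP; first exact: sub.
pose P w := nonneg w && in_span2 i j w.
have cs : inv_count a s = count P (roots a) by apply: inv_count_alt.
have e : {in roots a, inversion a s =1 predI P (inversion a s)}.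
  move=> w /mem_roots Rw /=; case: (boolP (inversion a s w)) => [/(sub w Rw)|];
  by rewrite /P ?andbT ?andbF // => ->.
have := count_predC (inversion a s) (filter P (roots a)).
rewrite size_filter !count_filter -cs /inv_count (eq_in_count e).
rewrite (@eq_count _ (predI (inversion a s) P) (predI P (inversion a s))); last first.
  by move=> w /=; rewrite andbC.
move=> /eqP; rewrite -[X in _ == X]addn0 eqn_add2l => /eqP c0 Pv.
apply: contraT => nv; have : has (predI (predC (inversion a s)) P) (roots a).
  by apply/hasP; exists v; [apply/mem_roots | rewrite /= nv].
by rewrite has_count c0.
Qed.

Lemma reduced_rank2_word a i j :
  size (rank2_word a i j) = inv_count a (rank2_word a i j).
Proof. by rewrite inv_count_alt // size_alt. Qed.

Lemma rank2_word_le a i j s :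
  inversion a s (alpha i) -> inversion a s (alpha j) ->
  inv_le a (rank2_word a i j) s.
Proof.
move=> si sj v Rv; rewrite inversion_rank2_word // => /andP[v0 vs].
exact: (span2_inversion si sj).
Qed.

Lemma inversion_rank2_word_l a i j : inversion a (rank2_word a i j) (alpha i).
Proof.
by rewrite inversion_rank2_word ?nonneg_alpha ?in_span2_alpha //; apply: root_alpha.
Qed.

Lemma inversion_rank2_word_r a i j : inversion a (rank2_word a i j) (alpha j).
Proof.
rewrite inversion_rank2_word ?nonneg_alpha 1?in_span2C ?in_span2_alpha //.
exact: root_alpha.
Qed.

Lemma rank2_word_cons a i j : exists s, rank2_word a i j = i :: s.
Proof.
have := inversion_rank2_word_l a i j; rewrite /rank2_word.
by case: rank2_count => [|n]; [rewrite inversion_nil | exists (alt j i n)].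
Qed.

Lemma src_rank2_word a i j : i != j ->
  src a (rank2_word a i j) = src a (rank2_word a j i).
Proof.
move=> ij; rewrite /rank2_word (rank2_countC a j i); set m := rank2_count a i j.
have := rank2_rho a ij; rewrite -src_alt_double -alt_cat_rev word_src_cat -/m.
move=> /(congr1 (fun b => src b (alt i j m))) <-.
by rewrite word_src_revV.
Qed.


(** * The two rank two words spell the same morphism *)

Lemma alt_rcons i j n : alt i j n.+1 = rcons (alt i j n) (if odd n then j else i).
Proof.
elim: n i j => // n IHn i j.
by rewrite -[LHS]/(i :: alt j i n.+1) IHn /=; case: (odd n).
Qed.

(** After the first letter, [- alpha i] is left, and the tail sends [alpha i] to a positive root.
    One more letter turns the tail into the full rank two word at [rho i a], which inverts
    [alpha i]; so that positive root is the simple root of the added letter. *)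
Lemma inv_map_rank2_word a i j :
  inv_map a (rank2_word a i j) (alpha i) =
  - alpha (if odd (rank2_count a i j) then j else i).
Proof.
have := inversion_rank2_word_l a i j.
have := inversion_rank2_word_r (rho i a) j i.
rewrite /rank2_word rank2_countC rank2_count_rho.
case: rank2_count => [|n]; first by rewrite inversion_nil.
rewrite [X in inversion (rho i a) X]alt_rcons -cats1 => ri.
rewrite [alt i j _]/= inversion_cons_alpha inv_map_cons sigma_alpha_self inv_mapN.
rewrite inversion_alpha negbK => zi; congr (- _).
move: ri; rewrite inversion_alpha inv_map_cat inv_map_cons id_lfunE.
rewrite (nonneg_sigma_iff _ (root_inv _ (root_alpha _ i)) zi) negbK => /eqP ->.
by rewrite /=; case: (odd n).
Qed.

Lemma inv_eq_rev_cat_nil a s t : inv_eq a s t -> inv_le (src a s) (rev s ++ t) [::].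
Proof.
move=> [st ts]; apply: inv_le_trans (inv_le_strip st ts) _.
by move=> v Rv; rewrite /inversion inv_map_rev_catV word_mapK id_lfunE.
Qed.

Lemma nonneg_inv_map a s k : inv_le a s [::] -> nonneg (inv_map a s (alpha k)).
Proof.
move=> s0; apply: contraT; rewrite -inversion_alpha => sk.
by have := s0 _ (root_alpha a k) sk; rewrite inversion_nil.
Qed.

(* The simple roots are the indecomposable positive roots,
   so they are permuted by a map preserving positivity both ways. *)
Lemma simple_root_permuted a s t k : inv_eq a s t ->
  exists k', inv_map a t (wmap a s (alpha k)) = alpha k'.
Proof.
move=> e; set x := inv_map a t (wmap a s (alpha k)).
have xE : inv_map (src a s) (rev s ++ t) (alpha k) = x by rewrite inv_map_rev_catV.
have yE v : inv_map (src a t) (rev t ++ s) v = inv_map a s (wmap a t v).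
  by rewrite inv_map_rev_catV.
have x0 : nonneg x by rewrite -xE; apply/nonneg_inv_map/inv_eq_rev_cat_nil.
have y0 l : nonneg (inv_map a s (wmap a t (alpha l))).
  by rewrite -yE; apply/nonneg_inv_map/inv_eq_rev_cat_nil/inv_eq_sym.
have Rx : R (src a t) x by apply/root_inv/root_word/root_alpha.
have [l xl] : exists l, x l != 0.
  apply/existsP; apply: contraT => /existsPn H.
  have /eqP[] := root_neq0 Rx; apply/ffunP => l; rewrite [RHS]ffunE.
  by apply/eqP; rewrite -[_ == _]negbK H.
exists l; have Ry : R (src a s) (inv_map a s (wmap a t (alpha l))).
  exact/root_inv/root_word/root_alpha.
have ye : inv_map a s (wmap a t (alpha l)) = alpha k.
  apply: (root_alpha_multiple Ry (y0 l)) => m mk.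
  have /ffunP/(_ m) : inv_map (src a t) (rev t ++ s) x = alpha k.
    by rewrite yE /x inv_mapK word_mapK.
  (* Off [k], a coordinate of [alpha k] is zero and a sum of nonnegative terms, so each term
     vanishes; the factor [x l] is nonzero. *)
  rewrite lfun_basis sum_ffunE alphaE (negPf mk) => /eqP.
  rewrite psumr_eq0 => [|l' _]; last first.
    by rewrite latticeZE yE; apply: mulr_ge0; apply/nonnegP.
  move=> /allP/(_ l); rewrite mem_index_enum => /(_ isT) /=.
  by rewrite latticeZE yE mulf_eq0 (negPf xl) => /eqP.
by rewrite /x -ye inv_mapK word_mapK.
Qed.

Lemma rank2_word_eq a i j : i != j ->
  word_eq a (rank2_word a i j) (rank2_word a j i).
Proof.
move=> ij; have e : inv_eq a (rank2_word a i j) (rank2_word a j i).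
  by split=> v Rv; rewrite !inversion_rank2_word // in_span2C.
split; first exact: src_rank2_word.
pose l := if odd (rank2_count a i j) then j else i.
pose l' := if odd (rank2_count a i j) then i else j.
have ll' : l != l' by rewrite /l /l'; case: odd => //; rewrite eq_sym.
have Pi : inv_map a (rank2_word a i j) (alpha i) = - alpha l.
  exact: inv_map_rank2_word.
have Qj : inv_map a (rank2_word a j i) (alpha j) = - alpha l'.
  by rewrite inv_map_rank2_word rank2_countC.
have lP k : k != l -> k != l' -> k != i /\ k != j.
  by rewrite /l /l'; case: odd.
set p := rank2_word a i j in e Pi *; set q := rank2_word a j i in e Qj *.
(* It remains to see that [x] is the identity. It permutes the simple roots and keeps all
   coordinates outside [l], [l'], so it fixes the simple roots outside and can at most exchange
   [alpha l] and [alpha l']. *)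
pose x v := inv_map a q (wmap a p v).
have xP v : x (inv_map a p v) = inv_map a q v by rewrite /x inv_mapK.
have xI : injective x.
  move=> u v /(congr1 (fun w => inv_map a p (wmap a q w))).
  by rewrite /x !inv_mapK !word_mapK.
have xK v k : k != l -> k != l' -> x v k = v k.
  move=> kl kl'; have [ki kj] := lP k kl kl'.
  rewrite -{2}[v](word_mapK a p) /p /rank2_word inv_map_alt_coord //.
  by rewrite /x /q /rank2_word inv_map_alt_coord.
have al k k' : alpha k k' != 0 :> int -> k = k'.
  by rewrite alphaE; have [->|] := eqVneq k' k.
have x_alpha k : exists2 k', x (alpha k) = alpha k' &
    (k != l -> k != l' -> k' = k) /\ ((k == l) || (k == l') -> (k' == l) || (k' == l')).
  have [k' xk] := simple_root_permuted k e; exists k'; first exact: xk.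
  split=> [kl kl'|kl].
    by apply: al; rewrite -xk xK // alphaE eqxx.
  rewrite -[_ || _]negbK negb_or; apply/negP => /andP[k'l k'l'].
  have := xK (alpha k) k' k'l k'l'; rewrite /x xk !alphaE eqxx.
  by case: eqP => // kk'; move: kl; rewrite -kk' (negPf k'l) (negPf k'l').
have xl : x (alpha l) = alpha l.
  have [k' xk [_]] := x_alpha l; rewrite eqxx => /(_ isT)/orP[]/eqP k'l'.
    by rewrite xk k'l'.
  move: xk; rewrite k'l' => xk.
  (* An exchange would make [q] treat [alpha i] and [alpha j] alike, by [Pi] and [Qj]. *)
  have : inv_map a q (alpha i) = inv_map a q (alpha j).
    by rewrite Qj -xP Pi -xk /x; rewrite !linearN.
  move=> /(congr1 (wmap a q)); rewrite !inv_mapK => /ffunP/(_ i).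
  by rewrite !alphaE eqxx (negPf ij).
have xl' : x (alpha l') = alpha l'.
  have [k' xk [_]] := x_alpha l'; rewrite eqxx orbT => /(_ isT)/orP[]/eqP k'l; last first.
    by rewrite xk k'l.
  move: xk; rewrite k'l -xl => /xI/ffunP/(_ l).
  by rewrite !alphaE eqxx (negPf ll').
have xid : (inv_map a q \o wmap a p)%VF = \1%VF.
  apply: eq_lfun_alpha => k; rewrite comp_lfunE id_lfunE -/(x _).
  have [->//|kl] := eqVneq k l; have [->//|kl'] := eqVneq k l'.
  by have [k' -> [-> //]] := x_alpha k.
apply/lfunP => v; have /lfunP/(_ (inv_map a p v)) := xid.
by rewrite comp_lfunE id_lfunE inv_mapK.
Qed.

(** * Matsumoto's theorem: the inversion set determines the morphism *)

Lemma inv_eq_cons a i s t : inv_eq (rho i a) s t <-> inv_eq a (i :: s) (i :: t).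
Proof.
split; first exact: (@inv_eq_catl a s t [:: i]).
move=> e; apply: inv_eq_trans (word_eq_inv_eq (word_eq_consK _ i t)).
apply: inv_eq_trans (inv_eq_sym (word_eq_inv_eq (word_eq_consK _ i s))) _.
by apply: (@inv_eq_catl (rho i a) _ _ [:: i]); rewrite /= cs_rhoK.
Qed.

Lemma word_eq_cons a i s t : word_eq (rho i a) s t -> word_eq a (i :: s) (i :: t).
Proof. by move=> e; apply: (@word_eq_cat a [:: i] [:: i]). Qed.

Lemma rank2_word_extend a i j s : size s = inv_count a s ->
    inversion a s (alpha i) -> inversion a s (alpha j) ->
  exists u, size (rank2_word a i j ++ u) = size s /\
            inv_eq a (rank2_word a i j ++ u) s.
Proof.
move=> rs_ si sj; set p := rank2_word a i j.
have ps : inv_le a p s by apply: rank2_word_le.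
have [u [su eu]] := exists_reduced (src a p) (rev p ++ s).
exists u; split; last first.
  exact: inv_eq_trans (inv_eq_catl eu) (word_eq_inv_eq (word_eq_revK a p s)).
rewrite size_cat su (inv_eq_count eu) rs_ -(inv_count_rev_cat_reduced _ ps).
  by rewrite reduced_rank2_word.
exact: reduced_rank2_word.
Qed.

(** For first letters [i != j], both words invert [alpha i] and [alpha j]. They are joined through
    two words that start with the two rank two words and share the rest [u]: the outer pairs agree
    in the first letter, and the middle pair is equal by [rank2_word_eq]. *)
Lemma reduced_word_inj a s t :
    size s = inv_count a s -> size t = inv_count a t -> inv_eq a s t ->
  word_eq a s t.
Proof.
have [n] := ubnP (size s); elim: n a s t => // n IHn a s t sn rs_ rt e.
have st : size s = size t by rewrite rs_ rt (inv_eq_count e).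
case: s t => [|i s] [|j t] // in sn rs_ rt e st *.
have same i' s' t' : (size (i' :: s') <= n)%N ->
    size (i' :: s') = inv_count a (i' :: s') ->
    size (i' :: t') = inv_count a (i' :: t') ->
    inv_eq a (i' :: s') (i' :: t') -> word_eq a (i' :: s') (i' :: t').
  move=> sn' /inversion_reduced_head[_ rs'] /inversion_reduced_head[_ rt'].
  by move=> /inv_eq_cons e'; apply/word_eq_cons/IHn.
have [ij|ij] := eqVneq i j.
  by rewrite -ij in e rt *; apply: same.
have [si _] := inversion_reduced_head rs_; have [tj _] := inversion_reduced_head rt.
have sj : inversion a (i :: s) (alpha j) by apply: (proj2 e) => //; apply: root_alpha.
have [u [su eu]] := rank2_word_extend rs_ si sj.
have pq := rank2_word_eq a ij.
have pqu : word_eq a (rank2_word a i j ++ u) (rank2_word a j i ++ u).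
  exact: word_eq_cat.
have eq_ : inv_eq a (rank2_word a j i ++ u) (j :: t).
  apply: inv_eq_trans e; apply: inv_eq_trans eu.
  exact/inv_eq_sym/word_eq_inv_eq.
have sq : size (rank2_word a j i ++ u) = size (j :: t).
  rewrite -st -su !size_cat /rank2_word !size_alt rank2_countC //.
have [p' pE] := rank2_word_cons a i j; have [q' qE] := rank2_word_cons a j i.
rewrite pE qE !cat_cons in su eu eq_ sq pqu.
apply: word_eq_trans (word_eq_trans pqu _).
  apply: same => //; last exact: inv_eq_sym.
  by rewrite su rs_ (inv_eq_count eu).
apply: same => //; first by rewrite sq -st.
by rewrite sq rt (inv_eq_count eq_).
Qed.

Lemma exists_reduced_word a s : exists t, size t = inv_count a t /\ word_eq a s t.
Proof.
elim: s a => [|i s IHs] a; first by exists [::]; rewrite inv_count_nil.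
have [t [rt st]] := IHs (rho i a).
have ist := word_eq_cons st.
have := inv_count_cons a i t; have [ti|ti] := boolP (inversion (rho i a) t (alpha i)).
  (* When [i] shortens [t], a reduced [u] with the inversions of [i :: t] is taken; then [i :: u]
     and [t] are reduced with equal inversion sets, so they spell the same morphism. *)
  move=> /= ct; have [u [ru eu]] := exists_reduced a (i :: t).
  exists u; split=> //; apply: word_eq_trans ist _.
  have e : inv_eq (rho i a) (i :: u) t.
    apply: inv_eq_trans (word_eq_inv_eq (word_eq_consK _ i t)).
    by apply: (proj1 (inv_eq_cons _ _ _ _)); rewrite cs_rhoK.
  have /word_eq_cons ut : word_eq (rho i a) (i :: u) t.
    by apply: reduced_word_inj => //; rewrite (inv_eq_count e) /= ru (inv_eq_count eu); lia.
  exact: word_eq_trans (word_eq_sym ut) (word_eq_consK a i u).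
by move=> /= ct; exists (i :: t); split=> //=; lia.
Qed.

Lemma inv_eq_word_eq a s t : inv_eq a s t -> word_eq a s t.
Proof.
move=> e; have [s' [rs' ss']] := exists_reduced_word a s.
have [t' [rt' tt']] := exists_reduced_word a t.
have [es et] := (word_eq_inv_eq ss', word_eq_inv_eq tt').
apply: word_eq_trans ss' (word_eq_trans _ (word_eq_sym tt')).
apply: reduced_word_inj => //; apply: inv_eq_trans et.
exact: inv_eq_trans (inv_eq_sym es) e.
Qed.

(** * Additivity of the count and inclusion of inversion sets *)

Lemma inv_count_rev_cat a s t : inv_le a s t ->
  (inv_count a s + inv_count (src a s) (rev s ++ t) = inv_count a t)%N.
Proof.
move=> st; have [r [rr sr]] := exists_reduced_word a s.
have er := word_eq_inv_eq sr; have rt := inv_le_trans (proj2 er) st.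
rewrite -(inv_count_rev_cat_reduced rr rt) (inv_eq_count er); congr addn.
have [es em] := (word_map_eq a s r).1 sr; rewrite /inv_count es.
apply: eq_count => v.
by rewrite /inversion inv_map_rev_catV -es inv_map_rev_catV em.
Qed.

Lemma inv_count_cat_le a s t :
  (inv_count a (s ++ t) <= size s + inv_count (src a s) t)%N.
Proof.
elim: s a => //= i s IHs a; have := inv_count_cons a i (s ++ t).
by have := IHs (rho i a); case: inversion => /=; lia.
Qed.

Lemma inv_le_count_cat_reduced a s t : size s = inv_count a s ->
    (inv_count a s + inv_count (src a s) t = inv_count a (s ++ t))%N ->
  inv_le a s (s ++ t).
Proof.
elim: s a => [|i s IHs] a; first by move=> *; apply: inv_le_nil.
move=> /[dup] ris /inversion_reduced_head[_ rs_].
rewrite -ris /= => ct; have := inv_count_cat_le (rho i a) s t.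
have := inv_count_cons a i (s ++ t).
(* Losing an inversion at the first letter would leave fewer than [ct] demands. *)
have [_|ni _ _] := boolP (inversion _ (s ++ t) _) => /=; first by lia.
have c' : (inv_count (rho i a) s + inv_count (src (rho i a) s) t =
          inv_count (rho i a) (s ++ t))%N.
  by have := inv_count_cons a i (s ++ t); rewrite (negPf ni) /=; lia.
have ii : inversion a (i :: s ++ t) (alpha i) by rewrite inversion_cons_alpha.
have [|_] := @inv_le_cat a [:: i] (i :: s ++ t) s (inv_le_seq1 ii); last exact.
apply: inv_le_trans (IHs _ rs_ c') _.
exact: (proj2 (word_eq_inv_eq (word_eq_consK (rho i a) i (s ++ t)))).
Qed.

Lemma inv_le_count_cat a s t :
    (inv_count a s + inv_count (src a s) t = inv_count a (s ++ t))%N ->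
  inv_le a s (s ++ t).
Proof.
have [r [rr sr]] := exists_reduced_word a s.
have er := word_eq_inv_eq sr.
have st : inv_eq a (s ++ t) (r ++ t) by apply/word_eq_inv_eq/word_eq_cat.
rewrite (inv_eq_count er) (inv_eq_count st) (proj1 sr) => c.
apply: inv_le_trans (proj1 er) _; apply: inv_le_trans (proj2 st).
exact: inv_le_count_cat_reduced.
Qed.

(** * Meets for inclusion of inversion sets *)

Definition inv_meet a (X : seq I -> Prop) m :=
  (forall t, X t -> inv_le a m t) /\
  (forall u, (forall t, X t -> inv_le a u t) -> inv_le a u m).

(* As in Newman's lemma: the greatest common lower bounds above two atoms agree,
   since both lie above the corresponding rank two word, itself a common lower
   bound. *)
Lemma exists_inv_meet a (X : seq I -> Prop) t0 : X t0 -> exists m, inv_meet a X m.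
Proof.
have [n] := ubnP (inv_count a t0); elim: n a X t0 => // n IHn a X t0 tn Xt0.
pose lb u := forall t, X t -> inv_le a u t.
(* Dividing by a lower bound [s] with inversions makes the count of [t0] drop. The meet of the
   quotients, multiplied back by [s], is the greatest of the lower bounds above [s]. *)
have above s : lb s -> (0 < inv_count a s)%N -> exists m,
    [/\ lb m, inv_le a s m & forall u, lb u -> inv_le a s u -> inv_le a u m].
  move=> ls s0; have st0 := inv_count_rev_cat (ls _ Xt0).
  pose Y t' := exists2 t, X t & t' = rev s ++ t.
  have [||m [lm gm]] := IHn (src a s) Y (rev s ++ t0); first by lia.
    by exists t0.
  have cat t : X t -> inv_le a s (s ++ m) /\ inv_le a (s ++ m) t.
    by move=> Xt; apply: inv_le_cat; [apply: ls | apply: lm; exists t].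
  exists (s ++ m); split; first by move=> t /cat[].
    by have [] := cat _ Xt0.
  move=> u lu su; have um : inv_le (src a s) (rev s ++ u) m.
    by apply: gm => _ [t Xt ->]; apply: inv_le_strip => //; apply: lu.
  have [sm _] := cat _ Xt0.
  apply: inv_le_trans (proj2 (word_eq_inv_eq (word_eq_revK a s u))) _.
  apply: (proj2 (inv_le_cat sm _)); apply: inv_le_trans um _.
  by move=> v Rv; rewrite /inversion inv_map_rev_catV inv_map_cat word_mapK.
have [[i li]|no] := pselect (exists i, lb [:: i]); last first.
  exists [::]; split=> [t _|u lu]; first exact: inv_le_nil.
  have [[i ui]|//] := simple_inversion_or_nil a u.
  by case: no; exists i => t /lu; apply: inv_le_trans; apply: inv_le_seq1.
have lb_inv u i' : lb u -> inversion a u (alpha i') -> lb [:: i'].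
  by move=> lu ui t Xt; apply: inv_le_trans (lu t Xt); apply: inv_le_seq1.
have pos1 i' : (0 < inv_count a [:: i'])%N.
  rewrite -has_count; apply/hasP; exists (alpha i'); last exact: inversion_seq1.
  exact/mem_roots/root_alpha.
have le1 i' u : inv_le a [:: i'] u -> inversion a u (alpha i').
  by apply; [apply: root_alpha | apply: inversion_seq1].
have [mi [lmi imi gmi]] := above _ li (pos1 i).
exists mi; split=> // u lu.
have [[j uj]|u0] := simple_inversion_or_nil a u; last first.
  exact: inv_le_trans u0 (inv_le_nil _).
have lj := lb_inv _ _ lu uj.
have [mj [lmj jmj gmj]] := above _ lj (pos1 j).
pose p := rank2_word a i j.
have lp : lb p by move=> t Xt; apply: rank2_word_le; apply: le1; [apply: li|apply: lj].
have ip : inv_le a [:: i] p by apply/inv_le_seq1/inversion_rank2_word_l.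
have jp : inv_le a [:: j] p by apply/inv_le_seq1/inversion_rank2_word_r.
have [|mp [lmp pmp gmp]] := above _ lp.
  exact: leq_trans (pos1 i) (inv_le_count ip).
(* The chain is [u], [mj], [mp], [mi]: [mj] is a lower bound above [p], and [mp] is one above
   [i]. *)
apply: (inv_le_trans (gmj u lu (inv_le_seq1 uj))).
apply: (@inv_le_trans _ _ mp); first exact: gmp (gmj _ lp jp).
exact: gmi (inv_le_trans ip pmp).
Qed.

(** * From words to morphisms of the groupoid *)

Definition represents a (x : wmor_to C a) s :=
  src a s = tag x /\ wmap a s = wmor_lin (tagged x).

Lemma exists_represents a (x : wmor_to C a) : exists s, represents x s.
Proof. by case: x => b w; have [s sw] := wmorP w; exists s. Qed.

Lemma represents_inj a (x y : wmor_to C a) s t :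
  represents x s -> represents y t -> inv_eq a s t -> x = y.
Proof.
move=> [xs xw] [ys yw] /inv_eq_word_eq/word_map_eq[st wst].
case: x y xs xw ys yw => [b w] [c w'] /= xs xw ys yw.
have bc : b = c by rewrite -xs st.
case: c / bc w' ys yw => w' _ yw; congr existT.
by apply: wmor_inj; rewrite -xw wst.
Qed.

(** No word is shorter than its number of inversions, and a reduced word for [w] attains it. *)
Lemma wlen_inv_count b a (w : wmor C b a) s :
  src a s = b -> wmap a s = wmor_lin w -> wlen w = inv_count a s.
Proof.
move=> sb sw; have same t : src a t = b -> wmap a t = wmor_lin w ->
    inv_count a t = inv_count a s.
  move=> tb tw; apply/inv_eq_count/word_eq_inv_eq/word_map_eq.
  by rewrite sb tb sw tw.
rewrite /wlen; case: ex_minnP => k /asboolP[t [<- tb tw]] kmin.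
apply/eqP; rewrite eqn_leq -{2}(same t) // inv_count_le_size andbT.
have [r [rr /word_map_eq[sr wr]]] := exists_reduced_word a s.
rewrite (same r) // -?sr -?wr // in rr; rewrite -rr.
by apply/kmin/asboolP; exists r; rewrite -sr -wr.
Qed.

(** Lengths are inversion counts, so additivity gives the inclusion; conversely [rev s ++ t] spells
    the required right factor. *)
Lemma weak_le_inv_le a (x y : wmor_to C a) s t :
  represents x s -> represents y t -> weak_le x y <-> inv_le a s t.
Proof.
case: x y => [b w] [c w'] [/= sb sw] [/= tc tw]; split.
  move=> [v [/= ev lv]]; have [u [uc uv]] := wmorP v.
  have suc : src a (s ++ u) = c by rewrite word_src_cat sb.
  have suw : wmap a (s ++ u) = wmor_lin (wcomp w v) by rewrite word_map_cat sb sw uv.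
  move: lv; rewrite (wlen_inv_count sb sw) (wlen_inv_count uc uv).
  rewrite (wlen_inv_count suc suw) /= => lv.
  rewrite -sb in lv; apply: inv_le_trans (inv_le_count_cat lv) _.
  apply: (proj1 (word_eq_inv_eq _)); apply/word_map_eq.
  by rewrite suc suw tc tw -ev.
move=> st; have vc : src b (rev s ++ t) = c by rewrite word_src_cat -sb word_src_rev.
have vP : exists u, src b u = c /\ wmap b u = wmap b (rev s ++ t).
  by exists (rev s ++ t).
have e : word_eq a (s ++ rev s ++ t) t := word_eq_revK a s t.
have [es em] := (word_map_eq _ _ _).1 e.
have wv : wmor_lin (wcomp w (WMor vP)) = wmor_lin w'.
  by rewrite /= -tw -em (word_map_cat C a s) -sw sb.
exists (WMor vP) => /=; split; first by apply: wmor_inj; rewrite wv.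
rewrite (wlen_inv_count sb sw) (@wlen_inv_count c a _ t) ?wv //.
rewrite (@wlen_inv_count c b _ (rev s ++ t)) //.
by have := inv_count_rev_cat st; rewrite sb.
Qed.

Lemma weak_order_meet_semilattice a : is_meet_semilattice (@weak_le I A C a).
Proof.
split; first split=> [x|x y|x y z].
- by have [s xs] := exists_represents x; apply/(weak_le_inv_le xs xs).
- have [s xs] := exists_represents x; have [t yt] := exists_represents y.
  move=> /(weak_le_inv_le xs yt) st /(weak_le_inv_le yt xs) ts.
  exact: (represents_inj xs yt).
- have [s xs] := exists_represents x; have [t yt] := exists_represents y.
  have [u zu] := exists_represents z.
  move=> /(weak_le_inv_le xs yt) st /(weak_le_inv_le yt zu) tu.
  exact/(weak_le_inv_le xs zu)/(inv_le_trans st tu).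
move=> X _ [x0 Xx0]; have [t0 x0t0] := exists_represents x0.
pose Y t := exists2 x, X x & represents x t.
have [|m [lm gm]] := @exists_inv_meet a Y t0; first by exists x0.
have mP : exists s, src a s = src a m /\ wmap a s = wmap a m by exists m.
pose z : wmor_to C a := existT _ (src a m) (WMor mP).
have zm : represents z m by [].
exists z; split=> [x Xx|y ly].
  have [t xt] := exists_represents x.
  by apply/(weak_le_inv_le zm xt)/lm; exists x.
have [u yu] := exists_represents y; apply/(weak_le_inv_le yu zm)/gm.
by move=> t [x Xx xt]; apply/(weak_le_inv_le yu xt)/ly.
Qed.

End RootSystem.
End WeylGroupoid.

Theorem theorem3p10 (I A : finType) (C : cartan_scheme I A)
    (hC : is_finite_root_system C (real_roots C)) (a : A) :
  is_meet_semilattice (@weak_le I A C a).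
Proof. exact: weak_order_meet_semilattice. Qed.
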